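(* The operators $D_+$, $D_-$ and $D_0$ on the graph algebra $\mathcal A$ commute with the action of the group $\Gamma$. In particular, the spaces $A_k$ and $P_k$ are $\Gamma$-invariant subspaces of $\mathcal A$.
   Context: Let $n$ be the number of vertices, $m=\binom n2$, $[m]=\{1,\dots,m\}$, and identify $[m]$ with the set of $2$-element subsets of $\{1,\dots,n\}$ (edges of $K_n$) via the lexicographic order. Each $\pi\in S_n$ permutes edges by $\{i,j\}\mapsto\{\pi(i),\pi(j)\}$; this gives a homomorphism $\varphi:S_n\to S_m$, whose image $\Gamma=\varphi(S_n)\subseteq S_m$ is the pair group. The graph algebra is $\mathcal A=\mathbb C[x_1,\dots,x_m]/(x_1^2-x_1,\dots,x_m^2-x_m)$, with vector space basis $\boldsymbol{x}_S=\prod_{e\in S}x_e$, $S\subseteq[m]$; $\Gamma$ acts linearly by $\gamma\cdot\boldsymbol{x}_S=\boldsymbol{x}_{\gamma(S)}$. For $0\le k\le m$, $A_k=\operatorname{span}_{\mathbb C}\{\boldsymbol{x}_S:|S|=k\}$, and $A_{-1}=0$. Linear operators: $D_+(\boldsymbol{x}_S)=\sum_{e\in[m]\setminus S}\boldsymbol{x}_{S\cup\{e\}}$, $D_-(\boldsymbol{x}_S)=\sum_{e\in S}\boldsymbol{x}_{S\setminus\{e\}}$, $D_0(\boldsymbol{x}_S)=-(m-2|S|)\boldsymbol{x}_S$ (empty sums are zero). The primitive spaces are $P_k=\ker(D_-:A_k\to A_{k-1})$. *)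

(* Defs.v *)
From HB Require Import structures.
From mathcomp Require Import all_boot all_order all_algebra all_fingroup.
From mathcomp Require Import ring_quotient complex zify.
From mathcomp Require Import boolp reals.
From mathcomp Require Import ssrcomplements mpoly.

Set Implicit Arguments.
Unset Strict Implicit.
Unset Printing Implicit Defensive.

Import GRing.Theory.
Local Open Scope ring_scope.
Local Open Scope quotient_scope.

(* [allpairs] is row-major and [filter] keeps the order, so this list is in
   lexicographic order. *)
Definition lex_pairs (n : nat) : seq ('I_n * 'I_n) :=
  [seq p : 'I_n * 'I_n <- [seq (i, j) | i <- enum 'I_n, j <- enum 'I_n]
     | (p.1 < p.2)%N].

Definition edge_seq (n : nat) : seq {set 'I_n} :=
  [seq [set p.1; p.2] | p <- lex_pairs n].

Definition edge (n : nat) (k : 'I_('C(n, 2))) : {set 'I_n} :=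
  nth set0 (edge_seq n) k.

Lemma mem_lex_pairs n p : (p \in lex_pairs n) = (p.1 < p.2)%N.
Proof.
rewrite mem_filter; case: p => i j /=.
by rewrite allpairs_f ?mem_enum ?andbT.
Qed.

Lemma edge_seq_uniq n : uniq (edge_seq n).
Proof.
rewrite map_inj_in_uniq; last first.
  move=> [i j] [k l]; rewrite !mem_lex_pairs /= => ij kl /setP E.
  have := E i; have := E j; have := E k; have := E l.
  rewrite !inE -!val_eqE /= => E1 E2 E3 E4.
  have [ik jl] : (i = k :> nat) /\ (j = l :> nat) by lia.
  by rewrite (val_inj ik) (val_inj jl).
rewrite filter_uniq // allpairs_uniq ?enum_uniq //.
by move=> [? ?] [? ?] _ _ [-> ->].
Qed.

Lemma mem_edge_seq n (e : {set 'I_n}) : (e \in edge_seq n) = (#|e| == 2).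
Proof.
apply/mapP/cards2P => [[[i j]]|[i [j [ij ->]]]].
  rewrite mem_lex_pairs /= => ij ->; exists i, j; split=> //.
  by rewrite -val_eqE /= (ltn_eqF ij).
case: (ltngtP i j) => [lt|gt|/val_inj eq]; last by rewrite eq eqxx in ij.
- by exists (i, j); rewrite ?mem_lex_pairs.
- by exists (j, i); rewrite ?mem_lex_pairs // setUC.
Qed.

Lemma size_edge_seq n : size (edge_seq n) = 'C(n, 2).
Proof.
rewrite -[n in RHS]card_ord -card_draws -(card_uniqP (edge_seq_uniq n)).
by apply: eq_card => e; rewrite mem_edge_seq inE.
Qed.

Lemma edge_inj n : injective (@edge n).
Proof.
move=> k l /eqP; rewrite nth_uniq ?size_edge_seq ?edge_seq_uniq //.
by move/eqP/val_inj.
Qed.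

Lemma edgeP n (e : {set 'I_n}) : reflect (exists k, edge k = e) (#|e| == 2).
Proof.
rewrite -mem_edge_seq; apply: (iffP idP) => [ein|[k <-]].
  have lt : (index e (edge_seq n) < 'C(n, 2))%N.
    by rewrite -size_edge_seq index_mem.
  by exists (Ordinal lt); rewrite /edge /= nth_index.
by rewrite mem_nth ?size_edge_seq.
Qed.

(* The default value [k] of [odflt] is never used, see [edge_mapE]. *)
Definition edge_map (n : nat) (s : 'S_n) (k : 'I_('C(n, 2))) : 'I_('C(n, 2)) :=
  odflt k [pick l | edge l == s @: edge k].

Lemma edge_mapE n (s : 'S_n) k : edge (edge_map s k) = s @: edge k.
Proof.
rewrite /edge_map; case: pickP => [l /eqP //|none].
have /edgeP [l El] : #|s @: edge k| == 2.
  by rewrite card_imset; [apply/edgeP; exists k | exact: perm_inj].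
by have := none l; rewrite El eqxx.
Qed.

Lemma edge_map_inj n (s : 'S_n) : injective (edge_map s).
Proof.
move=> k l E; apply: edge_inj; apply: (imset_inj (@perm_inj _ s)).
by rewrite -!edge_mapE E.
Qed.

Definition pair_perm (n : nat) (s : 'S_n) : 'S_('C(n, 2)) :=
  perm (@edge_map_inj n s).

Lemma pair_permE n (s : 'S_n) k : edge (pair_perm s k) = s @: edge k.
Proof. by rewrite permE edge_mapE. Qed.

Lemma pair_permM n :
  {in [set: 'S_n] &, {morph @pair_perm n : s t / (s * t)%g}}.
Proof.
move=> s t _ _; apply/permP => k; apply: edge_inj.
rewrite permM !pair_permE -imset_comp.
by apply: eq_imset => i; rewrite permM.
Qed.

Canonical pair_perm_morphism n := Morphism (@pair_permM n).

Definition pair_group (n : nat) : {group 'S_('C(n, 2))} :=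
  (@pair_perm n @* [set: 'S_n])%G.

Section GraphAlgebra.
Variables (F : fieldType) (m : nat).
Implicit Types (p q : {mpoly F[m]}) (S T : {set 'I_m}).

Definition idem_ideal : pred {mpoly F[m]} := fun p =>
  `[< exists q : 'I_m -> {mpoly F[m]}, p = \sum_i q i * ('X_i ^+ 2 - 'X_i) >].

Lemma idem_ideal_closed : idealr_closed idem_ideal.
Proof.
split=> [||a u v /asboolP [q ->] /asboolP [r ->]].
- apply/asboolP; exists (fun=> 0); rewrite big1 // => i _; exact: mul0r.
- apply/asboolP => -[q /(congr1 (meval (fun=> 0)))].
  rewrite rmorph1 rmorph_sum big1 => [|i _]; first by move/eqP; rewrite oner_eq0.
  by rewrite rmorphM rmorphB rmorphXn /= mevalXU expr0n subr0 mulr0.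
- apply/asboolP; exists (fun i => a * q i + r i).
  rewrite mulr_sumr -big_split /=; apply: eq_bigr => i _.
  by rewrite mulrDl mulrA.
Qed.

HB.instance Definition _ :=
  isIdealr.Build {mpoly F[m]} idem_ideal idem_ideal_closed.

Definition graph_alg := {ideal_quot (idem_ideal : idealr {mpoly F[m]})}.
HB.instance Definition _ := GRing.ComNzRing.on graph_alg.

Definition ga_pi : {mpoly F[m]} -> graph_alg := \pi_graph_alg.
HB.instance Definition _ := GRing.RMorphism.on ga_pi.

Definition ga_scale (c : F) (a : graph_alg) : graph_alg := ga_pi c%:MP * a.

Lemma ga_scaleA c d a : ga_scale c (ga_scale d a) = ga_scale (c * d) a.
Proof. by rewrite /ga_scale mulrA -rmorphM /= mpolyCM. Qed.
Lemma ga_scale1 : left_id 1 ga_scale.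
Proof. by move=> a; rewrite /ga_scale mpolyC1 rmorph1 mul1r. Qed.
Lemma ga_scaleDr : right_distributive ga_scale +%R.
Proof. by move=> c a b; rewrite /ga_scale mulrDr. Qed.
Lemma ga_scaleDl a : {morph ga_scale^~ a : c d / c + d}.
Proof. by move=> c d; rewrite /ga_scale mpolyCD rmorphD mulrDl. Qed.

HB.instance Definition _ := GRing.Zmodule_isLmodule.Build F graph_alg
  ga_scaleA ga_scale1 ga_scaleDr ga_scaleDl.

Lemma ga_scaleAl (c : F) (a b : graph_alg) : c *: (a * b) = (c *: a) * b.
Proof. exact: mulrA. Qed.
HB.instance Definition _ :=
  GRing.Lmodule_isLalgebra.Build F graph_alg ga_scaleAl.
HB.instance Definition _ := GRing.Lalgebra_isComAlgebra.Build F graph_alg.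

Lemma ga_piZ : scalable ga_pi.
Proof. by move=> c p; rewrite -mul_mpolyC rmorphM. Qed.
HB.instance Definition _ :=
  GRing.isScalable.Build F {mpoly F[m]} graph_alg *:%R ga_pi ga_piZ.

Definition xS S : graph_alg := \prod_(e in S) ga_pi 'X_e.

Lemma ga_X_idem e : ga_pi 'X_e * ga_pi 'X_e = ga_pi 'X_e.
Proof.
apply/eqP; rewrite -subr_eq0 -rmorphM -rmorphB /=.
rewrite -(rmorph0 ga_pi) /ga_pi -Quotient.idealrBE subr0.
apply/asboolP; exists (fun i => (i == e)%:R).
rewrite (bigD1 e) //= eqxx mul1r big1 ?addr0 ?expr2 // => i /negbTE ->.
exact: mul0r.
Qed.

(* The monomial 'X_[u] is congruent to the product of the variables that
   occur in it, so [coefS S p] is the coefficient of x_S in the class of p. *)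
Definition mnm_supp (u : 'X_{1..m}) : {set 'I_m} := [set i | u i != 0%N].

Definition coefS S p : F := \sum_(u <- msupp p | mnm_supp u == S) p@_u.

Lemma coefSE S p k : (msize p <= k)%N ->
  coefS S p = \sum_(u : 'X_{1..m < k} | mnm_supp u == S) p@_u.
Proof.
move=> le_pk; set I : subFinType _ := 'X_{1..m < k}.
rewrite /coefS big_mkcond (big_mksub I) ?msupp_uniq //=; first last.
  by move=> x /msize_mdeg_lt /leq_trans; apply.
rewrite big_mkcond [RHS]big_mkcond /=; apply: eq_bigr => u _.
by case: ifP => // /negbT /memN_msupp_eq0 ->; rewrite if_same.
Qed.

Lemma coefS_is_linear S : linear (coefS S : {mpoly F[m]} -> F^o).
Proof.
move=> c p q.
pose k := maxn (msize (c *: p + q)) (maxn (msize p) (msize q)).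
have [k1 k2 k3] : [/\ (msize (c *: p + q) <= k)%N,
    (msize p <= k)%N & (msize q <= k)%N] 
  by rewrite /k !leq_max !leqnn !orbT.
rewrite !(@coefSE S _ k) // scaler_sumr -big_split /=.
by apply: eq_bigr => u _; rewrite mcoeffD mcoeffZ.
Qed.
HB.instance Definition _ S :=
  GRing.isLinear.Build F {mpoly F[m]} F^o *:%R (coefS S) (@coefS_is_linear S).

Lemma coefSX S u : coefS S 'X_[u] = (mnm_supp u == S)%:R.
Proof.
by rewrite /coefS msuppX big_mkcond big_seq1 mcoeffX eqxx; case: eqP.
Qed.

Lemma coefS_ideal S p : p \in idem_ideal -> coefS S p = 0.
Proof.
move/asboolP => [q ->]; rewrite raddf_sum big1 //= => i _.
rewrite (mpolyE (q i)) mulr_suml raddf_sum big1 //= => u _.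
rewrite -scalerAl linearZ /= mulrBr raddfB /= expr2 -!mpolyXD !coefSX.
rewrite [X in _ *: (X - _)](_ : _ = (mnm_supp (u + U_(i)) == S)%:R).
  by rewrite subrr scaler0.
congr (_ == _)%:R; apply/setP => j; rewrite !inE !mnmDE mnm1E.
by case: (i == j) => /=; lia.
Qed.

Definition coord_xS S (a : graph_alg) : F := coefS S (generic_quotient.repr a).

Lemma ga_reprK (a : graph_alg) : ga_pi (generic_quotient.repr a) = a.
Proof. exact: reprK. Qed.

Lemma coord_xS_pi S p : coord_xS S (ga_pi p) = coefS S p.
Proof.
apply/eqP; rewrite -subr_eq0 -[X in X == _](raddfB (coefS S)) /=.
apply/eqP/coefS_ideal.
by rewrite [_ \in _]Quotient.idealrBE reprK.
Qed.

Lemma coord_xS_is_linear S : linear (coord_xS S : graph_alg -> F^o).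
Proof.
move=> c a b; rewrite -[a]ga_reprK -[b]ga_reprK.
by rewrite -linearP !coord_xS_pi linearP.
Qed.
HB.instance Definition _ S :=
  GRing.isLinear.Build F graph_alg F^o *:%R (coord_xS S) (@coord_xS_is_linear S).

Lemma ga_piX u : ga_pi 'X_[u] = xS (mnm_supp u).
Proof.
rewrite mpolyXE_id rmorph_prod /xS [RHS]big_mkcond /=.
apply: eq_bigr => i _; rewrite inE rmorphXn /=.
case: (u i) => [|k] //=; elim: k => // k IH.
by rewrite exprS IH; exact: ga_X_idem.
Qed.

Lemma coord_xSxS S T : coord_xS S (xS T) = (S == T)%:R.
Proof.
pose u : 'X_{1..m} := [multinom (i \in T : nat) | i < m].
have suppu : mnm_supp u = T.
  by apply/setP => i; rewrite inE mnmE; case: (i \in T).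
by rewrite -suppu -ga_piX coord_xS_pi coefSX suppu eq_sym.
Qed.

Lemma xS_decomp (a : graph_alg) : a = \sum_S coord_xS S a *: xS S.
Proof.
rewrite -[a]ga_reprK; move: (generic_quotient.repr a) => p.
rewrite {1}[p]mpolyE raddf_sum /=.
rewrite [RHS](eq_bigr (fun S => coefS S p *: xS S)); last first.
  by move=> S _; rewrite coord_xS_pi.
rewrite (partition_big mnm_supp predT) //=; apply: eq_bigr => S _.
rewrite scaler_suml; apply: eq_bigr => u /eqP <-.
by rewrite linearZ /= ga_piX.
Qed.

Definition ga_v2r (a : graph_alg) : 'rV[F]_#|{set 'I_m}| :=
  \row_j coord_xS (enum_val j) a.

Lemma ga_vector_axiom : vector_axiom_def #|{set 'I_m}| graph_alg.
Proof.
exists ga_v2r => [c a b|].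
  by apply/rowP => j; rewrite !mxE linearP.
exists (fun r : 'rV_#|{set 'I_m}| => \sum_S r 0 (enum_rank S) *: xS S) => [a|r].
  rewrite [RHS]xS_decomp; apply: eq_bigr => S _.
  by rewrite mxE enum_rankK.
apply/rowP => j; rewrite mxE linear_sum (bigD1 (enum_val j)) //= linearZ /=.
rewrite coord_xSxS eqxx enum_valK big1 ?addr0 => [|S nS].
  exact: mulr1.
by rewrite linearZ /= coord_xSxS eq_sym (negbTE nS); exact: mulr0.
Qed.
HB.instance Definition _ :=
  Lmodule_hasFinDim.Build F graph_alg ga_vector_axiom.

Section LinearExtension.
Variables (V : vectType F) (f : {set 'I_m} -> V).

Definition lin_ext_fun (a : graph_alg) : V := \sum_S coord_xS S a *: f S.

Lemma lin_ext_fun_is_linear : linear lin_ext_fun.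
Proof.
move=> c a b; rewrite scaler_sumr -big_split /=; apply: eq_bigr => S _.
by rewrite linearP /= scalerDl scalerA.
Qed.
HB.instance Definition _ :=
  GRing.isLinear.Build F graph_alg V *:%R lin_ext_fun lin_ext_fun_is_linear.

Definition lin_ext : 'Hom(graph_alg, V) := linfun lin_ext_fun.

Lemma lin_extE S : lin_ext (xS S) = f S.
Proof.
rewrite lfunE /= /lin_ext_fun (bigD1 S) //= coord_xSxS eqxx scale1r.
by rewrite big1 ?addr0 // => T /negbTE nT; rewrite coord_xSxS nT scale0r.
Qed.

End LinearExtension.

Definition Dplus : 'End(graph_alg) :=
  lin_ext (fun S => \sum_(e in ~: S) xS (S :|: [set e])).

Definition Dminus : 'End(graph_alg) :=
  lin_ext (fun S => \sum_(e in S) xS (S :\ e)).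

Definition Dzero : 'End(graph_alg) :=
  lin_ext (fun S => - (m%:R - 2 * #|S|%:R) *: xS S).

(* [perm] multiplication composes from left to right, cf. [ga_actM]. *)
Definition ga_act (g : 'S_m) : 'End(graph_alg) :=
  lin_ext (fun S => xS (g @: S)).

Lemma DplusE S : Dplus (xS S) = \sum_(e in ~: S) xS (S :|: [set e]).
Proof. exact: lin_extE. Qed.

Lemma DminusE S : Dminus (xS S) = \sum_(e in S) xS (S :\ e).
Proof. exact: lin_extE. Qed.

Lemma DzeroE S : Dzero (xS S) = - (m%:R - 2 * #|S|%:R) *: xS S.
Proof. exact: lin_extE. Qed.

Lemma ga_actE g S : ga_act g (xS S) = xS (g @: S).
Proof. exact: lin_extE. Qed.

Lemma ga_hom_ext (f g : 'End(graph_alg)) :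
  (forall S, f (xS S) = g (xS S)) -> f = g.
Proof.
move=> fg; apply/lfunP => a; rewrite (xS_decomp a) !linear_sum.
by apply: eq_bigr => S _; rewrite !linearZ /= fg.
Qed.

Lemma ga_act1 : ga_act 1%g = \1%VF.
Proof.
apply: ga_hom_ext => S; rewrite ga_actE id_lfunE; congr xS.
by rewrite -[RHS]imset_id; apply: eq_imset => e; rewrite perm1.
Qed.

Lemma ga_actM g h : ga_act (g * h)%g = (ga_act h \o ga_act g)%VF.
Proof.
apply: ga_hom_ext => S; rewrite comp_lfunE !ga_actE -imset_comp; congr xS.
by apply: eq_imset => e; rewrite permM.
Qed.

Definition A_ (k : nat) : {vspace graph_alg} :=
  <<[seq xS T | T in [set T : {set 'I_m} | #|T| == k]]>>%VS.

Definition P_ (k : nat) : {vspace graph_alg} := (A_ k :&: lker Dminus)%VS.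

End GraphAlgebra.

(* Main.v *)
Require Import Defs.
From HB Require Import structures.
From mathcomp Require Import all_boot all_order all_algebra all_fingroup.
From mathcomp Require Import complex reals.

Import GRing.Theory.
Local Open Scope ring_scope.
Local Open Scope complex_scope.

(** The three operators only use the inclusion of sets and their cardinals, and
both are respected by every permutation [g] of the index set ['I_m], in
particular by the permutations of edges that come from permutations of vertices.
All maps involved are linear, so it is enough to compare them on the basis
[xS S].  There [Dplus] and [Dminus] are sums over the elements outside,
respectively inside, [S]; as [g] carries these elements bijectively onto those
outside, respectively inside, [g @: S], the sum attached to [g @: S] is the
image under [g] of the sum attached to [S] ([Dplus_act], [Dminus_act]).  [Dzero]
scales [xS S] by a function of the cardinal of [S], which [g] preserves
([Dzero_act]).

Preservation of cardinals also shows that [g] permutes the spanning family of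
[A_ k] ([ga_act_A]).  As [g] commutes with [Dminus], it preserves the kernel of
[Dminus] too, hence the intersection [P_ k] of [A_ k] with that kernel
([ga_act_P]). *)

(** Re-indexing along [e |-> g e] works because [g] is injective: [g e] lies
outside [g @: S] exactly when [e] lies outside [S]. *)
Lemma Dplus_act (F : fieldType) (m : nat) (g : 'S_m) :
  (Dplus F m \o ga_act F g = ga_act F g \o Dplus F m)%VF.
Proof.
apply: ga_hom_ext => S; rewrite !comp_lfunE ga_actE !DplusE linear_sum /=.
rewrite (reindex_inj (@perm_inj _ g)) /=.
apply: eq_big => [e|e _]; first by rewrite !inE mem_imset //; exact: perm_inj.
by rewrite ga_actE imsetU imset_set1.
Qed.

(** The re-indexing of [Dplus_act], with injectivity of [g] used once more to
commute the removal of [e] with the image under [g]. *)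
Lemma Dminus_act (F : fieldType) (m : nat) (g : 'S_m) :
  (Dminus F m \o ga_act F g = ga_act F g \o Dminus F m)%VF.
Proof.
apply: ga_hom_ext => S; rewrite !comp_lfunE ga_actE !DminusE linear_sum /=.
rewrite (reindex_inj (@perm_inj _ g)) /=.
apply: eq_big => [e|e _]; first by rewrite mem_imset //; exact: perm_inj.
rewrite ga_actE; congr xS; apply/setP=> f.
(* Every index is [g] of some index, so membership can be tested before [g]. *)
rewrite -[f](permKV g) !inE.
by rewrite !mem_imset ?inE ?(inj_eq perm_inj) //; exact: perm_inj.
Qed.

Lemma Dzero_act (F : fieldType) (m : nat) (g : 'S_m) :
  (Dzero F m \o ga_act F g = ga_act F g \o Dzero F m)%VF.
Proof.
apply: ga_hom_ext => S; rewrite !comp_lfunE ga_actE !DzeroE linearZ /= ga_actE.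
by rewrite card_imset //; exact: perm_inj.
Qed.

Lemma ga_act_A (F : fieldType) (m : nat) (g : 'S_m) (k : nat) :
  (ga_act F g @: A_ F m k <= A_ F m k)%VS.
Proof.
rewrite limg_span; apply/span_subvP => _ /mapP[_ /imageP[S Sk ->] ->].
rewrite ga_actE; apply/memv_span/image_f.
by move: Sk; rewrite !inE card_imset //; exact: perm_inj.
Qed.

Lemma ga_act_P (F : fieldType) (m : nat) (g : 'S_m) (k : nat) :
  (ga_act F g @: P_ F m k <= P_ F m k)%VS.
Proof.
apply/subvP => _ /memv_imgP[a + ->]; rewrite !memv_cap => /andP[aA].
rewrite !memv_ker => /eqP a0; apply/andP; split.
  by apply: (subvP (ga_act_A F m g k)); exact: memv_img.
by rewrite -comp_lfunE Dminus_act comp_lfunE a0 linear0.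
Qed.

Theorem theorem4p2 (R : realType) (n : nat) :
  (forall g : 'S_('C(n, 2)), g \in pair_group n ->
     [/\ (Dplus R[i] 'C(n, 2) \o ga_act R[i] g)%VF
           = (ga_act R[i] g \o Dplus R[i] 'C(n, 2))%VF,
         (Dminus R[i] 'C(n, 2) \o ga_act R[i] g)%VF
           = (ga_act R[i] g \o Dminus R[i] 'C(n, 2))%VF
       & (Dzero R[i] 'C(n, 2) \o ga_act R[i] g)%VF
           = (ga_act R[i] g \o Dzero R[i] 'C(n, 2))%VF]) /\
  (forall k : nat, (k <= 'C(n, 2))%N ->
     forall g : 'S_('C(n, 2)), g \in pair_group n ->
       (ga_act R[i] g @: A_ R[i] 'C(n, 2) k <= A_ R[i] 'C(n, 2) k)%VS /\
       (ga_act R[i] g @: P_ R[i] 'C(n, 2) k <= P_ R[i] 'C(n, 2) k)%VS).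
Proof.
split=> [g _|k _ g _].
  by split; [exact: Dplus_act | exact: Dminus_act | exact: Dzero_act].
by split; [exact: ga_act_A | exact: ga_act_P].
Qed.
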